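(* Let $X$ be a real Hilbert space, $E\subset X$ a nonempty subset, $f:E\to\mathbb{R}$, $G:E\to X$ functions, and $M>0$. Suppose that $(f,G)$ satisfies property $(CW^{1,\omega})$ with constant $M$ on $E$, that is, $$f(x)\ge f(y)+\langle G(y),x-y\rangle+M\varphi^*\Big(\frac1M\|G(x)-G(y)\|\Big)\quad\text{for all }x,y\in E.$$ Then the formula $$F=\mathrm{conv}(g),\qquad g(x)=\inf_{y\in E}\big\{f(y)+\langle G(y),x-y\rangle+M\varphi(\|x-y\|)\big\},\quad x\in X,$$ defines a $C^{1,\omega}$ convex function $F:X\to\mathbb{R}$ with $F|_E=f$ and $(\nabla F)|_E=G$, and $$\|\nabla F(x)-\nabla F(y)\|\le4M\,\omega(2\|x-y\|)\quad\text{for all }x,y\in X.$$ In particular, $M_\omega(\nabla F)\le8M$.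
   Context: $\omega:[0,+\infty)\to[0,+\infty)$ is a concave, strictly increasing, continuous function with $\omega(0)=0$ and $\lim_{t\to+\infty}\omega(t)=+\infty$; $\varphi(t)=\int_0^t\omega(s)\,ds$ for $t\ge0$, and $\varphi^*(t)=\sup_{s\ge0}\{ts-\varphi(s)\}$ for $t\ge0$. For $g:X\to\mathbb{R}$, the convex envelope is $\mathrm{conv}(g)(x)=\sup\{\phi(x):\phi\text{ is convex, proper and lower semicontinuous on }X,\ \phi\le g\}$. For a map $G$ from a subset $E$ of $X$ to $X$, $M_\omega(G)=\sup_{x\ne y,\ x,y\in E}\frac{\|G(x)-G(y)\|}{\omega(\|x-y\|)}$. $F$ is of class $C^{1,\omega}$ if it is differentiable on $X$ and $M_\omega(\nabla F)<\infty$. *)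

(* Defs.v *)
From HB Require Import structures.
From mathcomp Require Import all_boot all_order all_algebra.
From mathcomp Require Import sesquilinear.
From mathcomp Require Import all_classical all_reals all_analysis.

Set Implicit Arguments.
Unset Strict Implicit.
Unset Printing Implicit Defensive.

Import Order.TTheory GRing.Theory Num.Theory.
Import numFieldNormedType.Exports.

Local Open Scope classical_set_scope.
Local Open Scope ring_scope.

Section Modulus.
Context {R : realType}.

(* [w] is only constrained on [0, +oo[; its values at negative reals are never
   used below. *)
Definition modulus (w : R -> R) : Prop :=
  (forall t, 0 <= t -> 0 <= w t) /\
  [/\ convex_function (`[0, +oo[%classic : set R^o) (fun t => - w t),
      {in `[0, +oo[ &, {homo w : s t / s < t}},
      {within `[0, +oo[, continuous w},
      w 0 = 0
    & w t @[t --> +oo] --> +oo].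

Definition primitive (w : R -> R) (t : R) : R :=
  \int[lebesgue_measure]_(s in `[0, t]) w s.

(* Extended-real valued, so that the supremum is unconditionally meaningful. *)
Definition conjugate (phi : R -> R) (t : R) : \bar R :=
  ereal_sup [set (t * s - phi s)%:E | s in `[0, +oo[].

End Modulus.

Section ConvexEnvelope.
Context {R : realType} {X : normedModType R}.

Definition proper_function (h : X -> \bar R) : Prop :=
  (forall x, h x != -oo%E) /\ (exists x, h x != +oo%E).

(* Used for functions that never take the value -oo, so no +oo - oo occurs;
   at the end points 0 * +oo = 0 makes the inequality trivial. *)
Definition econvex_function (h : X -> \bar R) : Prop :=
  forall (t : R) (x y : X), 0 <= t <= 1 ->
    (h (t *: x + (1 - t) *: y)%R <= t%:E * h x + (1 - t)%R%:E * h y)%E.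

Definition convex_envelope (g : X -> R) (x : X) : \bar R :=
  ereal_sup [set h x | h in [set h : X -> \bar R |
    [/\ econvex_function h, proper_function h, lower_semicontinuous h
      & forall z, (h z <= (g z)%:E)%E]]].

End ConvexEnvelope.

Section Hilbert.
Context {R : realType} {X : completeNormedModType R}.
(* A real Hilbert space is a complete normed space [X] with a symmetric positive
   definite bilinear form [ip] inducing the norm. *)
Variable ip : {dot X for idfun}.

Definition inner_product_norm : Prop := forall x : X, `|x| ^+ 2 = ip x x.

Definition CW (w : R -> R) (E : set X) (f : X -> R) (G : X -> X) (M : R) :
    Prop :=
  forall x y, E x -> E y ->
    ((f x)%:E >= (f y + ip (G y) (x - y))%R%:E
                 + M%:E * conjugate (primitive w) (M^-1 * `|G x - G y|)%R)%E.

Definition upper_function (w : R -> R) (E : set X) (f : X -> R) (G : X -> X)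
    (M : R) (x : X) : \bar R :=
  ereal_inf [set (f y + ip (G y) (x - y) + M * primitive w `|x - y|)%:E
            | y in E].

(* When [E] has at most one point the supremum is over the empty set, and equals
   -oo rather than the conventional 0; nonnegative upper bounds and finiteness
   (being < +oo) are unaffected. *)
Definition modulus_seminorm (w : R -> R) (E : set X) (G : X -> X) : \bar R :=
  ereal_sup [set (`|G p.1 - G p.2| / w `|p.1 - p.2|)%:E
            | p in [set p : X * X | [/\ E p.1, E p.2 & p.1 != p.2]]].

Definition is_gradient (F : X -> R) (x v : X) : Prop :=
  differentiable (F : X -> R^o) x /\
  forall h, 'd (F : X -> R^o) x h = ip v h.

(* The gradient is unique as [ip] is positive definite. *)
Definition grad (F : X -> R) (x : X) : X := xget 0 [set v | is_gradient F x v].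

(* By Riesz's theorem the first clause says that [F] is differentiable; stating
   it with [grad] makes explicit that the default value of [xget] is not used. *)
Definition C1w (w : R -> R) (F : X -> R) : Prop :=
  (forall x, is_gradient F x (grad F x)) /\
  (modulus_seminorm w [set: X] (grad F) < +oo)%E.

End Hilbert.

(* Main.v *)
Require Import Defs.
From HB Require Import structures.
From mathcomp Require Import all_boot all_order all_algebra.
From mathcomp Require Import sesquilinear.
From mathcomp Require Import all_classical all_reals all_analysis.
From mathcomp Require Import ring lra.
Import Order.TTheory GRing.Theory Num.Theory.
Import numFieldNormedType.Exports.
Local Open Scope classical_set_scope.
Local Open Scope ring_scope.

(** Let phi be the primitive of w, and let g be the infimum over y in E of the
    majorants x |-> f y + <G y, x - y> + M phi |x - y|.

    Young's inequality turns the condition CW into the statement that each of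
    these majorants lies above each affine function x |-> f z + <G z, x - z>
    with z in E ([affine_le_majorant]).  So g is finite, and its convex envelope
    F lies between these affine functions and g.  This makes F real valued and
    equal to f on E, with G z a subgradient of F at every z in E.

    The regularity of F comes from a bound on second differences.  As w t / t is
    nonincreasing, phi is a concave function of t ^ 2; together with the
    parallelogram law this gives
      phi |u + h| + phi |u - h| <= 2 phi |u| + 2 phi |h|
    ([primitive_parallelogram]), hence
      g (x + h) + g (x - h) - 2 g x <= 2 M phi |h|.
    For fixed h this says that x |-> (F (x + h) + F (x - h)) / 2 - M phi |h| is
    a minorant of g.  It is convex and lower semicontinuous, hence it is also
    below the envelope F: the second differences of F obey the same bound
    ([envelope_diff2]).

    A convex function whose second differences are at most rho |h|, with
    rho t = o(t), has linear directional derivatives, and Riesz's theorem turns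
    them into subgradients ([subgradient_exists]).  The remainder
    F (x + h) - F x - <v, h> of a subgradient v lies between 0 and rho |h|, so
    that v is the gradient ([subgradient_is_gradient]).  Comparing the
    lower bound at x with the upper bound at y, in the direction of
    the difference of the two gradients, gives
      |grad F x - grad F y| |x - y| <= 2 rho |x - y|
    ([subgradient_dist]).  For rho = 2 M phi the right-hand side is at most
    4 M |x - y| w |x - y|, because phi t <= t w t. *)

Set Implicit Arguments.
Unset Strict Implicit.

(** * The primitive of a modulus *)

Section PrimitiveOfModulus.
Context {R : realType} {w : R -> R} (w_modulus : modulus w).
Let phi := primitive w.

Lemma modulus_le s t : 0 <= s -> s <= t -> w s <= w t.
Proof.
case: w_modulus => _ [_ w_incr _ _ _] s0.
rewrite le_eqVlt => /predU1P[->//|st]; apply/ltW/w_incr => //;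
  by rewrite in_itv/= andbT // (le_trans s0 (ltW st)).
Qed.

(** A concave function vanishing at 0 has nonincreasing slopes [w t / t]. *)
Lemma modulus_ratio c t : 0 < c -> 0 <= t -> t <= c -> w c * t <= w t * c.
Proof.
move=> c0 t0 tc; case: w_modulus => _ [w_conc _ _ w0 _].
have tc1 : t / c <= 1 by rewrite ler_pdivrMr// mul1r.
have := w_conc (Itv01 (divr_ge0 t0 (ltW c0)) tc1) c 0.
rewrite !inE/= !in_itv/= !andbT => /(_ (ltW c0) (lexx _)).
rewrite !convRE /conv/= w0 scaler0 addr0 oppr0 mulr0 addr0.
rewrite [_ *: _]divfK ?gt_eqF// mulrN lerN2 => h.
by rewrite -ler_pdivrMr//; rewrite (_ : w c * t / c = t / c * w c)//; ring.
Qed.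

Lemma modulus_continuous t : 0 < t -> {for t, continuous w}.
Proof.
move=> t0; case: w_modulus => _ [_ _ /continuous_within_itvcyP[cw _] _ _].
by apply: cw; rewrite in_itv/= t0.
Qed.

Lemma modulus_cvg0 e : 0 < e ->
  exists2 d, 0 < d & forall t, 0 <= t -> t < d -> w t < e.
Proof.
case: w_modulus => w_ge0 [_ _ /continuous_within_itvcyP[_ cw] w0 _] e0.
move/cvgrPdist_lt/(_ _ e0) : cw => [d /= d0 cw].
exists d => // t; rewrite le_eqVlt => /predU1P[<- _|t0 td]; first by rewrite w0.
have t0' := ltW t0; have := cw t; rewrite /ball/= w0 !sub0r !normrN.
by rewrite !ger0_norm ?w_ge0//; apply.
Qed.

Lemma modulus_integrable u :
  lebesgue_measure.-integrable `[0, u] (EFin \o w).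
Proof.
apply: continuous_compact_integrable; first exact: segment_compact.
case: w_modulus => _ [_ _ cw _ _].
by apply: continuous_subspaceW cw => x/=; rewrite !in_itv/= andbT => /andP[].
Qed.

Lemma primitive_derivable t : 0 < t -> derivable phi t 1 /\ derive1 phi t = w t.
Proof.
move=> t0; apply: (@continuous_FTC1_closed _ w 0 t (t + 1)) => //.
- by rewrite ltrDl.
- exact: modulus_integrable.
- exact: modulus_continuous.
Qed.

Lemma primitive_within_continuous a b : 0 <= a -> a <= b ->
  {within `[a, b], continuous phi}.
Proof.
move=> a0 ab; apply: (@continuous_subspaceW _ _ `[a, b] `[0, b]).
  by move=> x/=; rewrite !in_itv/= => /andP[ax ->]; rewrite (le_trans a0 ax).
apply: parameterized_integral_continuous; first exact: le_trans ab.
exact: modulus_integrable.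
Qed.

Lemma primitive_ge0 t : 0 <= phi t.
Proof.
apply: Rintegral_ge0 => s /=; rewrite in_itv/= => /andP[s0 _].
by case: w_modulus => + _; apply.
Qed.

Lemma primitive0 : phi 0 = 0.
Proof. by rewrite /phi /primitive set_itv1 Rintegral_set1. Qed.

(** Since [phi] has derivative [w], every bound on [phi] below is obtained by
    comparing [w] with the derivative of a linear or quadratic function. *)
Lemma primitive_comparison (Q Q' : R -> R) a b : 0 <= a -> a <= b ->
    (forall s, is_derive s (1 : R) Q (Q' s)) ->
  ((forall s, a < s < b -> w s <= Q' s) -> phi b - phi a <= Q b - Q a) /\
  ((forall s, a < s < b -> Q' s <= w s) -> Q b - Q a <= phi b - phi a).
Proof.
move=> a0 ab dQ.
have dphi s : s \in `]a, b[ -> is_derive s (1 : R) (phi - Q) (w s - Q' s).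
  rewrite in_itv/= => /andP[as_ sb].
  have [dp p'] := primitive_derivable (le_lt_trans a0 as_).
  have dphi : is_derive s (1 : R) phi (w s).
    by apply: DeriveDef; rewrite -?derive1E.
  exact: is_deriveB.
have cQ : {within `[a, b], continuous (phi - Q)}.
  apply: within_continuousB; first exact: primitive_within_continuous.
  apply: continuous_subspaceT => s.
  apply: differentiable_continuous; apply/derivable1_diffP.
  by have [] := dQ s.
split=> h.
- have := @ler0_derive1_le_cc _ (phi - Q) a b _ _ cQ b a.
  rewrite !in_itv/= !lexx ab => H.
  suff : phi b - Q b <= phi a - Q a by lra.
  apply: H => // [s sab|s sab]; first by have [] := dphi _ sab.
  have [_] := dphi _ sab; rewrite derive1E => ->.
  by rewrite subr_le0; apply: h; rewrite in_itv in sab.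
- have := @ger0_derive1_le_cc _ (phi - Q) a b _ _ cQ a b.
  rewrite !in_itv/= !lexx ab => H.
  suff : phi a - Q a <= phi b - Q b by lra.
  apply: H => // s sab; first by have [] := dphi _ sab.
  have [_] := dphi _ sab; rewrite derive1E => ->.
  by rewrite subr_ge0; apply: h; rewrite in_itv in sab.
Qed.

Lemma primitive_le t : 0 <= t -> phi t <= t * w t.
Proof.
move=> t0.
have dQ (s : R) : is_derive s (1 : R) (fun x => w t * x) (w t).
  by apply: is_derive_eq; rewrite [LHS]mulr1 ?mulr1 //.
have [+ _] := primitive_comparison (lexx 0) t0 dQ.
rewrite primitive0 mulr0 !subr0 mulrC; apply => s /andP[s0 st].
by apply: modulus_le; apply: ltW.
Qed.

(** The concave function [s |-> phi (sqrt s)] lies below its tangent at [c ^ 2],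
    because [w t / t] is nonincreasing. *)
Lemma primitive_tangent c p : 0 < c -> 0 <= p ->
  phi p <= phi c + w c / c / 2 * (p ^+ 2 - c ^+ 2).
Proof.
move=> c0 p0; set k := w c / c.
have dQ (s : R) : is_derive s (1 : R) (fun x => k / 2 * x ^+ 2) (k * s).
  by apply: is_derive_eq; rewrite /GRing.scale/=; field.
have [pc|/ltW cp] := lerP p c.
- have [_ h] := primitive_comparison p0 pc dQ.
  suff : k / 2 * c ^+ 2 - k / 2 * p ^+ 2 <= phi c - phi p by lra.
  apply: h => s /andP[ps sc]; have s0 := le_lt_trans p0 ps.
  by rewrite mulrAC ler_pdivrMr// modulus_ratio// ltW.
- have [h _] := primitive_comparison (ltW c0) cp dQ.
  suff : phi p - phi c <= k / 2 * p ^+ 2 - k / 2 * c ^+ 2 by lra.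
  apply: h => s /andP[cs sp]; have s0 := lt_trans c0 cs.
  by rewrite mulrAC ler_pdivlMr// modulus_ratio// ltW.
Qed.

(** [phi t / t ^ 2] is nonincreasing: the tangent at [a ^ 2] of
    [s |-> phi (sqrt s)] is nonnegative at 0 and bounds the value at [c ^ 2]. *)
Lemma primitive_ratio a c : 0 <= a -> a <= c ->
  a ^+ 2 * phi c <= c ^+ 2 * phi a.
Proof.
rewrite le_eqVlt => /predU1P[<- _|a0 ac].
  by rewrite primitive0 expr0n/= mul0r mulr0.
have c0 := lt_le_trans a0 ac.
have t0 := primitive_tangent a0 (lexx 0).
have tc := primitive_tangent a0 (ltW c0).
move: t0 tc; rewrite primitive0 expr0n/=.
set k := _ / _ / 2; set A := a ^+ 2; set C := c ^+ 2 => t0 tc.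
have A0 : 0 <= A by rewrite exprn_ge0// ltW.
have AC : 0 <= C - A by rewrite subr_ge0 ler_pXn2r// nnegrE ltW.
have : A * phi c <= A * (phi a + k * (C - A)) by rewrite ler_wpM2l.
have : 0 <= (phi a + k * (0 - A)) * (C - A) by rewrite mulr_ge0.
lra.
Qed.

(** With [c ^ 2 = a ^ 2 + b ^ 2], the point [c ^ 2] is the mean of [p ^ 2] and
    [q ^ 2], so concavity of [s |-> phi (sqrt s)] bounds the left-hand side by
    [2 * phi c]; a concave function vanishing at 0 is also subadditive, which
    bounds [phi c] by [phi a + phi b].  The hypothesis is the parallelogram law
    for [p = `|u + v|] and [q = `|u - v|]. *)
Lemma primitive_parallelogram a b p q :
    0 <= a -> 0 <= b -> 0 <= p -> 0 <= q ->
    p ^+ 2 + q ^+ 2 = 2 * (a ^+ 2 + b ^+ 2) ->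
  phi p + phi q <= 2 * phi a + 2 * phi b.
Proof.
move=> a0 b0 p0 q0 pq; pose c := Num.sqrt (a ^+ 2 + b ^+ 2).
have c0 : 0 <= c by exact: sqrtr_ge0.
have cE : c ^+ 2 = a ^+ 2 + b ^+ 2 by rewrite sqr_sqrtr// addr_ge0// exprn_ge0.
have le_c (x : R) : 0 <= x -> x ^+ 2 <= c ^+ 2 -> x <= c.
  by move=> x0; rewrite ler_pXn2r.
have ac : a <= c by apply: le_c; rewrite // cE lerDl exprn_ge0.
have bc : b <= c by apply: le_c; rewrite // cE lerDr exprn_ge0.
move: (c0); rewrite le_eqVlt => /predU1P[c_eq0|c_gt0].
  have sq0 (x : R) : x ^+ 2 <= 0 -> x = 0.
    by move=> x0; apply/eqP; rewrite -sqrf_eq0 eq_le x0 sqr_ge0.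
  move: pq; rewrite -cE -c_eq0 expr0n/= mulr0 => pq.
  have -> : p = 0 by apply: sq0; rewrite -pq lerDl sqr_ge0.
  have -> : q = 0 by apply: sq0; rewrite -pq lerDr sqr_ge0.
  by rewrite primitive0 addr0 addr_ge0// mulr_ge0// primitive_ge0.
have tp := primitive_tangent c_gt0 p0.
have tq := primitive_tangent c_gt0 q0.
have ra := primitive_ratio a0 ac.
have rb := primitive_ratio b0 bc.
have pqc : phi p + phi q <= 2 * phi c.
  apply: (le_trans (lerD tp tq)); rewrite addrACA -mulrDr.
  have -> : p ^+ 2 - c ^+ 2 + (q ^+ 2 - c ^+ 2) = 0 by rewrite cE; lra.
  by rewrite mulr0 addr0 mulr2n mulrDl mul1r.
apply: (le_trans pqc); rewrite -mulrDr ler_pM2l//.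
rewrite -(ler_pM2l (exprn_gt0 2 c_gt0)) {1}cE mulrDl mulrDr.
exact: lerD.
Qed.

End PrimitiveOfModulus.

(** * Inner products and the Riesz representation theorem *)

Section InnerProduct.
Context {R : realType} {X : completeNormedModType R} {ip : {dot X for idfun}}.
Context (ip_norm : inner_product_norm ip).
Implicit Types u v : X.

Lemma ipC u v : ip u v = ip v u.
Proof. by rewrite hermC expr0 mul1r. Qed.

Lemma ipDl u v z : ip (u + v) z = ip u z + ip v z.
Proof. exact: linearDl. Qed.

Lemma ipDr u v z : ip z (u + v) = ip z u + ip z v.
Proof. exact: linearDr. Qed.

Lemma ipNl u z : ip (- u) z = - ip u z.
Proof. exact: linearNl. Qed.

Lemma ipNr u z : ip z (- u) = - ip z u.
Proof. exact: linearNr. Qed.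

Lemma ipBl u v z : ip (u - v) z = ip u z - ip v z.
Proof. by rewrite ipDl ipNl. Qed.

Lemma ipBr u v z : ip z (u - v) = ip z u - ip z v.
Proof. by rewrite ipDr ipNr. Qed.

Lemma ipZr (a : R) u z : ip z (a *: u) = a * ip z u.
Proof. exact: linearZr_LR. Qed.

Lemma ipZl (a : R) u z : ip (a *: u) z = a * ip u z.
Proof. by rewrite ipC ipZr ipC. Qed.

Lemma sqr_normD u v : `|u + v| ^+ 2 = `|u| ^+ 2 + 2 * ip u v + `|v| ^+ 2.
Proof. by rewrite !ip_norm ipDl !ipDr (ipC v u); ring. Qed.

Lemma sqr_normB u v : `|u - v| ^+ 2 = `|u| ^+ 2 - 2 * ip u v + `|v| ^+ 2.
Proof. by rewrite sqr_normD normrN ipNr; ring. Qed.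

Lemma parallelogram u v :
  `|u + v| ^+ 2 + `|u - v| ^+ 2 = 2 * (`|u| ^+ 2 + `|v| ^+ 2).
Proof. by rewrite sqr_normD sqr_normB; ring. Qed.

Lemma cauchy_schwarz u v : ip u v <= `|u| * `|v|.
Proof.
have [->|u0] := eqVneq u 0.
  by rewrite normr0 mul0r -(scale0r 0) ipZl mul0r.
have [->|v0] := eqVneq v 0.
  by rewrite normr0 mulr0 -(scale0r 0) ipZr mul0r.
have u_gt0 : 0 < `|u| by rewrite normr_gt0.
have v_gt0 : 0 < `|v| by rewrite normr_gt0.
have := sqr_ge0 `| `|v| *: u - `|u| *: v|.
rewrite sqr_normB !normrZ !normr_id ipZl ipZr => h.
have : 0 <= 2 * (`|u| * `|v|) * (`|u| * `|v| - ip u v) by lra.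
by rewrite pmulr_rge0 ?subr_ge0// !mulr_gt0.
Qed.

Lemma ip_norm_le u v : `|ip u v| <= `|u| * `|v|.
Proof.
by rewrite ler_norml lerNl -ipNr cauchy_schwarz// -(normrN v) cauchy_schwarz.
Qed.

Lemma ip_eq0 v : (forall h, ip v h = 0) -> v = 0.
Proof.
by move=> /(_ v)/eqP; rewrite -ip_norm sqrf_eq0 normr_eq0 => /eqP.
Qed.

(** The representing vector minimizes [J v = `|v| ^ 2 / 2 - L v].  By the
    parallelogram law a minimizing sequence is Cauchy, and the first variation
    of [J] at its limit [v] is [ip v h - L h]. *)
Lemma riesz (L : X -> R) (K : R) :
    (forall u v, L (u + v) = L u + L v) ->
    (forall a u, L (a *: u) = a * L u) ->
    (forall u, L u <= K * `|u|) ->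
  exists v, forall h, L h = ip v h.
Proof.
move=> LD LZ LK; pose J v := `|v| ^+ 2 / 2 - L v.
have J_ge v : - (K ^+ 2 / 2) <= J v.
  rewrite /J; have := LK v; have := sqr_ge0 (`|v| - K); rewrite sqrrB; lra.
pose m := inf (range J).
have Jinf : has_inf (range J).
  split; first by exists (J 0), 0.
  by exists (- (K ^+ 2 / 2)) => _ [v _ <-].
have mJ v : m <= J v by apply: ge_inf; [case: Jinf | exists v].
have J_mid u v : `|u - v| ^+ 2 / 4 = J u + J v - 2 * J (2^-1 *: (u + v)).
  have := parallelogram u v; rewrite /J LZ LD normrZ ger0_norm ?invr_ge0//.
  by rewrite exprMn; lra.
have close u v e : J u <= m + e -> J v <= m + e -> `|u - v| ^+ 2 <= 8 * e.
  by have := mJ (2^-1 *: (u + v)); have := J_mid u v; lra.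
have /choice[x xP] : forall n : nat, exists v, J v <= m + n.+1%:R^-1.
  move=> n; have n0 : 0 < n.+1%:R^-1 :> R by rewrite invr_gt0.
  by have [_ [v _ <-] /ltW Jv] := inf_adherent n0 Jinf; exists v.
have x_cvg : cvgn x.
  apply/cauchy_cvgP/cauchy_exP => e e0.
  (* With this tolerance [close] gives points at distance at most [e / 4]. *)
  have e8 : 0 < (e / 4) ^+ 2 / 8 by rewrite divr_gt0// exprn_gt0// divr_gt0.
  have [N _ NP] := near_infty_natSinv_lt (PosNum e8).
  exists (x N); exists N => // n /= Nn; rewrite -ball_normE/=.
  have le_e k : (N <= k)%N -> J (x k) <= m + (e / 4) ^+ 2 / 8.
    by move=> Nk; rewrite (le_trans (xP k))// lerD2l ltW//; apply: NP.
  have := close _ _ _ (le_e _ (leqnn N)) (le_e _ Nn).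
  have e4 : 0 <= e / 4 by rewrite divr_ge0// ltW.
  rewrite mulrC divfK// ler_pXn2r ?nnegrE// => /le_lt_trans; apply.
  by rewrite ltr_pdivrMr// ltr_pMr// ltr1n.
pose v := limn x; exists v => h.
(* The increment [J (v + t *: h) - J v], bounded below through the [x n]. *)
have variation t : 0 <= t * (ip v h - L h) + t ^+ 2 * `|h| ^+ 2 / 2.
  apply/ler_addgt0Pr => e e0; set c := 1 + `|t| * `|h|.
  have c0 : 0 < c by rewrite ltr_wpDr// mulr_ge0.
  have ec0 : 0 < e / c by rewrite divr_gt0.
  have [n [n_small vn]] : exists n, n.+1%:R^-1 < e / c /\ `|v - x n| < e / c.
    have /cvgrPdist_lt/(_ _ ec0) xv := x_cvg.
    near \oo => n; exists n; split; near: n; last exact: xv.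
    exact: (near_infty_natSinv_lt (PosNum ec0)).
  have ipe : t * ip (x n - v) h <= `|t| * `|h| * (e / c).
    rewrite -ipZr; apply: le_trans (cauchy_schwarz _ _) _.
    by rewrite normrZ mulrC distrC ler_wpM2l ?mulr_ge0// ltW.
  have ee : e = e / c + `|t| * `|h| * (e / c).
    by rewrite /c; field; rewrite gt_eqF.
  have := le_trans (xP n) (lerD (mJ (x n + t *: h)) (lexx _)).
  rewrite /J LD LZ sqr_normD ipZr normrZ exprMn real_normK ?num_real//.
  move: ipe n_small ee; rewrite ipBl; move: (e / c) (n.+1%:R^-1) => e' n'; lra.
set D := ip v h - L h; pose a := `|h| ^+ 2 / 2.
have a1 : 0 < 1 + a by rewrite ltr_wpDr// divr_ge0// exprn_ge0.
(* [t * D + t ^ 2 * a] is negative at [t = - D / (1 + a)] unless [D = 0]. *)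
have := variation (- D / (1 + a)); rewrite -/D => D_ge0.
have : 0 <= - D ^+ 2 / (1 + a) ^+ 2.
  apply: (le_trans D_ge0); rewrite le_eqVlt; apply/orP; left; apply/eqP.
  by rewrite /a; field; rewrite gt_eqF.
rewrite pmulr_lge0 ?invr_gt0 ?exprn_gt0// oppr_ge0 => D2.
have : D == 0 by rewrite -sqrf_eq0 eq_le D2 sqr_ge0.
by rewrite subr_eq0 => /eqP.
Unshelve. all: by end_near. Qed.

End InnerProduct.

(** * Convex functions with small second differences *)

Definition subgradient {R : realType} {X : completeNormedModType R}
    (ip : X -> X -> R) (F : X -> R) (x v : X) : Prop :=
  forall h, F x + ip v h <= F (x + h).

Section ConvexGradient.
Context {R : realType} {X : completeNormedModType R} {ip : {dot X for idfun}}.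
Context (ip_norm : inner_product_norm ip).

Lemma is_gradient_unique F x v v' :
  is_gradient ip F x v -> is_gradient ip F x v' -> v = v'.
Proof.
move=> [_ dv] [_ dv']; apply/eqP; rewrite -subr_eq0; apply/eqP.
by apply: (ip_eq0 ip_norm) => h; rewrite ipBl -dv -dv' subrr.
Qed.

Lemma gradE F x v : is_gradient ip F x v -> grad ip F x = v.
Proof.
move=> Fv; rewrite /grad; case: xgetP => [v' _ Fv'|/(_ v)//].
exact: is_gradient_unique Fv' Fv.
Qed.

Context {F : X -> R} {rho : R -> R}.
Context (F_convex : forall t x y, 0 <= t <= 1 ->
  F (t *: x + (1 - t) *: y) <= t * F x + (1 - t) * F y).
Context (rho_small : forall e, 0 < e ->
  exists2 d, 0 < d & forall t, 0 <= t -> t < d -> rho t <= e * t).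
Context (F_diff2 : forall x h,
  F (x + h) + F (x - h) <= 2 * F x + rho `|h|).

(** The subgradient inequality at [- h] bounds [F (x - h)] from below, so the
    second-difference bound controls [F (x + h)] from above. *)
Lemma subgradient_remainder x v h : subgradient ip F x v ->
  F (x + h) <= F x + ip v h + rho `|h|.
Proof. by move=> /(_ (- h)); rewrite ipNr; have := F_diff2 x h; lra. Qed.

Lemma subgradient_is_gradient x v :
  subgradient ip F x v -> is_gradient ip F x v.
Proof.
move=> Fv.
have ip_cont : continuous (ip v : X -> R^o).
  apply: bounded_linear_continuous; apply/ linear_boundedP.
  near=> K => u; apply: le_trans (ip_norm_le ip_norm _ _) _.
  by rewrite ler_wpM2r//.
have expansion : F \o shift x = cst (F x) + (ip v : X -> R^o) +o_0 id.
  apply/eqaddoP => e e0; have [d d0 rd] := rho_small e0.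
  apply/nbhs_norm0P; exists d => //= h hd.
  rewrite !fctE/= [h + x]addrC.
  have := Fv h; have := subgradient_remainder h Fv.
  have := rd _ (normr_ge0 h) hd.
  by rewrite ler_norml; lra.
have dF : 'd (F : X -> R^o) x = ip v :> (X -> R^o).
  exact: (@diff_unique _ _ _ (F : X -> R^o) (ip v)).
split; last by move=> h; rewrite dF.
by apply/diff_locallyP; rewrite dF.
Unshelve. all: by end_near. Qed.

(** Evaluate at [y + h] the lower bound given by [u] and the upper bound given by
    [v], where [h] has the length of [x - y] and the direction of [u - v]; the
    values of [F] at [x] and [y] are eliminated by the upper bound at [x]. *)
Lemma subgradient_dist x y u v : subgradient ip F x u -> subgradient ip F y v ->
  `|u - v| * `|x - y| <= 2 * rho `|x - y|.
Proof.
move=> Fu Fv; have [->|uv] := eqVneq u v.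
  rewrite subrr normr0 mul0r mulr_ge0// distrC.
  by have := subgradient_remainder (y - x) Fu; have := Fu (y - x); lra.
have uv0 : 0 < `|u - v| by rewrite normr_gt0 subr_eq0.
pose h := (`|x - y| / `|u - v|) *: (u - v).
have hE : `|h| = `|x - y|.
  by rewrite normrZ ger0_norm ?divr_ge0// divfK// gt_eqF.
have ip_h : ip (u - v) h = `|u - v| * `|x - y|.
  by rewrite ipZr -ip_norm; field; rewrite gt_eqF.
have := subgradient_remainder h Fv; have := subgradient_remainder (y - x) Fu.
have := Fu (y - x + h); rewrite addrA subrKC hE (distrC y) -ip_h ipBl ipDr; lra.
Qed.

Section DirectionalDerivative.
Context (x : X).

Let q h t := (F (x + t *: h) - F x) / t.
(** By convexity the difference quotients decrease as [t] decreases to 0, so this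
    infimum is the directional derivative of [F] at [x]. *)
Let L h := inf [set q h t | t in [set t | 0 < t]].

Let q_mono h s t : 0 < s -> s <= t -> q h s <= q h t.
Proof.
move=> s0 st; have t0 := lt_le_trans s0 st.
have st1 : 0 <= s / t <= 1.
  by rewrite (divr_ge0 (ltW s0) (ltW t0))/= ler_pdivrMr// mul1r.
have := F_convex (x + t *: h) x st1.
have -> : (s / t) *: (x + t *: h) + (1 - s / t) *: x = x + s *: h.
  rewrite scalerDr scalerA divfK ?gt_eqF// scalerBl scale1r.
  by rewrite addrAC [X in X + _]addrC subrK.
rewrite /q ler_pdivrMr// => h'.
have -> : (F (x + t *: h) - F x) / t * s =
    s / t * (F (x + t *: h) - F x) by ring.
by lra.
Qed.

(** [x] is the barycenter of [x + t *: h] and [x - h] with weights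
    [1 / (1 + t)] and [t / (1 + t)]. *)
Let q_ge h t : 0 < t -> F x - F (x - h) <= q h t.
Proof.
move=> t0; have t1 : 0 < 1 + t by rewrite addr_gt0.
have tt1 : 0 <= (1 + t)^-1 <= 1 by rewrite invr_ge0 ltW//= invf_le1// lerDl ltW.
have := F_convex (x + t *: h) (x - h) tt1.
have tE : 1 - (1 + t)^-1 = (1 + t)^-1 * t by field; rewrite gt_eqF.
have -> : (1 + t)^-1 *: (x + t *: h) + (1 - (1 + t)^-1) *: (x - h) = x.
  rewrite tE -scalerA -scalerDr scalerBr addrACA subrr addr0.
  have -> : x + t *: x = (1 + t) *: x by rewrite scalerDl scale1r.
  by rewrite scalerA mulVf ?scale1r// gt_eqF.
rewrite tE -mulrA -mulrDr -ler_pdivrMl ?invr_gt0// invrK => h'.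
by rewrite /q ler_pdivlMr//; lra.
Qed.

Let q_has_inf h : has_inf [set q h t | t in [set t | 0 < t]].
Proof.
split; first by exists (q h 1), 1 => //=.
by exists (F x - F (x - h)) => _ [t t0 <-]; exact: q_ge.
Qed.

Let L_le h t : 0 < t -> L h <= q h t.
Proof. by move=> t0; apply: ge_inf; [case: (q_has_inf h) | exists t]. Qed.

Let L_ge h c : (forall t, 0 < t -> c <= q h t) -> c <= L h.
Proof.
move=> hc; apply: lb_le_inf; first by case: (q_has_inf h).
by move=> _ [t t0 <-]; exact: hc.
Qed.

Let LZ_pos a h : 0 < a -> L (a *: h) = a * L h.
Proof.
have le_Z b u : 0 < b -> b * L u <= L (b *: u).
  move=> b0; apply: L_ge => t t0.
  rewrite -ler_pdivlMl//; apply: le_trans (L_le u (mulr_gt0 t0 b0)) _.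
  rewrite /q scalerA le_eqVlt; apply/orP; left; apply/eqP.
  by field; rewrite !gt_eqF.
move=> a0; apply/le_anti; rewrite le_Z// andbT.
have a'0 : 0 < a^-1 by rewrite invr_gt0.
rewrite -ler_pdivrMl//; apply: le_trans (le_Z _ _ a'0) _.
by rewrite scalerA mulVf ?scale1r// gt_eqF.
Qed.

Let L_subadd u v : L (u + v) <= L u + L v.
Proof.
rewrite -lerBlDl; apply: L_ge => t t0; rewrite lerBlDl -lerBlDr.
apply: L_ge => s s0; rewrite lerBlDr.
pose m := Num.min s t; have m0 : 0 < m by rewrite lt_min s0.
have m20 : 0 < m / 2 by rewrite divr_gt0.
apply: le_trans (L_le _ m20) _.
apply: (@le_trans _ _ (q u m + q v m)); last first.
  by apply: lerD; apply: q_mono; rewrite // ge_min lexx ?orbT.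
have half : 0 <= (2^-1 : R) <= 1 by lra.
have := F_convex (x + m *: u) (x + m *: v) half.
have -> : 1 - 2^-1 = 2^-1 :> R by lra.
have -> : 2^-1 *: (x + m *: u) + 2^-1 *: (x + m *: v) =
    x + (m / 2) *: (u + v).
  rewrite !scalerDr addrACA -scalerDl !scalerA [2^-1 * m]mulrC.
  by rewrite (_ : 2^-1 + 2^-1 = 1 :> R) ?scale1r//; lra.
rewrite /q -mulrDl ler_pdivrMr// => h'.
set A := F (x + m *: u) - F x + (F (x + m *: v) - F x).
have -> : A / m * (m / 2) = A / 2 by field; rewrite gt_eqF.
by rewrite /A; lra.
Qed.

Let L0 : L 0 = 0.
Proof. by have := LZ_pos 0 (@ltr0n R 2); rewrite scaler0; lra. Qed.

(** The sum [L h + L (- h)] is at most [rho (t * `|h|) / t] for every [t > 0],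
    which tends to 0: this is what upgrades sublinearity to linearity. *)
Let LN h : L (- h) = - L h.
Proof.
have := L_subadd h (- h); rewrite subrr L0 => Lh.
suff : L h + L (- h) <= 0 by lra.
apply/ler_addgt0Pl => e e0; rewrite addr0.
pose k := 1 + `|h|; have k0 : 0 < k by rewrite ltr_wpDr.
have [d d0 rd] := rho_small (divr_gt0 e0 k0).
pose t := d / 2 / k; have t0 : 0 < t by rewrite !divr_gt0.
apply: le_trans (lerD (L_le h t0) (L_le (- h) t0)) _.
rewrite /q -mulrDl ler_pdivrMr// scalerN.
have := F_diff2 x (t *: h).
have thE : `|t *: h| = t * `|h| by rewrite normrZ gtr0_norm.
have thk : t * `|h| <= t * k by rewrite ler_pM2l// lerDr.
have tkE : t * k = d / 2 by rewrite /t divfK// gt_eqF.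
have : rho `|t *: h| <= e / k * `|t *: h|.
  by apply: rd => //; rewrite thE; lra.
have : e / k * (t * `|h|) <= e * t.
  rewrite (_ : e * t = e / k * (t * k)); last by field; rewrite gt_eqF.
  by rewrite ler_pM2l// divr_gt0.
by rewrite thE; lra.
Qed.

(** The bound on [F] near [x] makes the directional derivative a bounded linear
    form; the difference quotient at [t = 1] dominates it, hence its Riesz
    representative is a subgradient. *)
Lemma subgradient_exists B : (forall h, `|h| <= 1 -> F (x + h) <= F x + B) ->
  exists v, subgradient ip F x v.
Proof.
move=> F_bounded.
have LD u v : L (u + v) = L u + L v.
  have := L_subadd u v; have := L_subadd (- u) (- v).
  by rewrite -opprD !LN; lra.
have LZ (a : R) u : L (a *: u) = a * L u.
  have [a0|a0|->] := ltgtP a 0; last by rewrite scale0r mul0r L0.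
  - by rewrite -[in LHS](opprK a) scaleNr LN LZ_pos ?oppr_gt0// mulNr opprK.
  - exact: LZ_pos.
have LB u : L u <= B * `|u|.
  have [->|u0] := eqVneq u 0; first by rewrite L0 normr0 mulr0.
  have nu : 0 < `|u| by rewrite normr_gt0.
  have nu' : 0 < `|u|^-1 by rewrite invr_gt0.
  apply: le_trans (L_le _ nu') _; rewrite /q invrK ler_pM2r//.
  by rewrite lerBlDl F_bounded// normrZ gtr0_norm// mulVf// gt_eqF.
have [v Lv] := riesz ip_norm LD LZ LB; exists v => h.
have := L_le h ltr01; rewrite -Lv /q scale1r divr1; lra.
Qed.

End DirectionalDerivative.
End ConvexGradient.

(** * Convex envelopes *)

Section Envelope.
Context {R : realType} {X : completeNormedModType R} {ip : {dot X for idfun}}.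
Context (ip_norm : inner_product_norm ip).

Lemma convex_envelope_le (g : X -> R) x : (convex_envelope g x <= (g x)%:E)%E.
Proof. by apply: ge_ereal_sup => _ [h [_ _ _ hg] <-]. Qed.

Lemma convex_envelope_ge (g k : X -> R) x :
    (forall t x y, 0 <= t <= 1 ->
      k (t *: x + (1 - t) *: y) <= t * k x + (1 - t) * k y) ->
    lower_semicontinuous (fun z => (k z)%:E) -> (forall z, k z <= g z) ->
  ((k x)%:E <= convex_envelope g x)%E.
Proof.
move=> k_convex k_lsc kg; apply: ereal_sup_ubound => /=.
exists (fun z => (k z)%:E) => //.
by split=> //; split; [move=> z | exists 0].
Qed.

Lemma affine_lsc (c : R) (v : X) :
  lower_semicontinuous (fun z => (c + ip v z)%:E).
Proof.
move=> x a; rewrite lte_fin => ax.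
pose e := (c + ip v x - a) / (1 + `|v|).
have v1 : 0 < 1 + `|v| by rewrite ltr_wpDr.
have e0 : 0 < e by rewrite divr_gt0// subr_gt0.
exists (ball x e); first exact: nbhsx_ballx.
move=> y; rewrite -ball_normE/= lte_fin => xy.
have := cauchy_schwarz ip_norm v (x - y); rewrite ipBr => h.
have : `|v| * `|x - y| < (1 + `|v|) * e.
  apply: (@le_lt_trans _ _ ((1 + `|v|) * `|x - y|)); last by rewrite ltr_pM2l.
  by rewrite ler_wpM2r// lerDr.
rewrite /e mulrC [X in _ < X]mulrC divfK ?gt_eqF//; lra.
Qed.

Lemma affine_le_convex_envelope (g : X -> R) (c : R) (v : X) x :
  (forall z, c + ip v z <= g z) -> ((c + ip v x)%:E <= convex_envelope g x)%E.
Proof.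
apply: (@convex_envelope_ge g (fun z => c + ip v z)) => [t a b _|].
  by rewrite ipDr !ipZr; lra.
exact: affine_lsc.
Qed.

Context {g F : X -> R} (FE : forall x, (F x)%:E = convex_envelope g x).

Lemma envelope_convex t x y : 0 <= t <= 1 ->
  F (t *: x + (1 - t) *: y) <= t * F x + (1 - t) * F y.
Proof.
move=> t01; rewrite -lee_fin FE; apply: ge_ereal_sup => _ [h h_adm <-].
have hF z : (h z <= (F z)%:E)%E.
  by rewrite FE; apply: ereal_sup_ubound; exists h.
case: h_adm => h_convex _ _ _; apply: le_trans (h_convex _ _ _ t01) _.
have /andP[t0 t1] := t01; rewrite [leRHS]EFinD !EFinM.
by rewrite leeD// lee_wpmul2l// lee_fin subr_ge0.
Qed.

Lemma envelope_lsc : lower_semicontinuous (fun x => (F x)%:E).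
Proof.
move=> x a; rewrite FE => /ereal_sup_gt[_ [h h_adm <-] ah].
have hF z : (h z <= (F z)%:E)%E.
  by rewrite FE; apply: ereal_sup_ubound; exists h.
case: h_adm => _ _ h_lsc _; have [V xV Va] := h_lsc _ _ ah.
by exists V => // y /Va /lt_le_trans; apply.
Qed.

Lemma envelope_shift_near (x h : X) (e : R) : 0 < e ->
  \forall y \near x, F (x + h) - e < F (y + h).
Proof.
move=> e0; have [|V xV Va] := @envelope_lsc (x + h) (F (x + h) - e).
  by rewrite lte_fin gtrBl.
have : {for x, continuous (fun y : X => y + h)}.
  by apply: cvgD; [exact: cvg_id | exact: cvg_cst].
move=> /(_ V xV) xV'; apply: (filterS _ (xV' : nbhs x _)) => y /Va.
by rewrite lte_fin.
Qed.

(** The average of the two translates of [F], lowered by [C / 2], is convex, lower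
    semicontinuous and below [g], hence below the envelope of [g]. *)
Lemma envelope_diff2 C x h : (forall z, g (z + h) + g (z - h) <= 2 * g z + C) ->
  F (x + h) + F (x - h) <= 2 * F x + C.
Proof.
move=> gC; pose k z := (F (z + h) + F (z - h) - C) / 2.
suff : k x <= F x by rewrite /k; lra.
have Fg z : F z <= g z by rewrite -lee_fin FE convex_envelope_le.
rewrite -lee_fin FE; apply: convex_envelope_ge; last first.
- move=> z; rewrite /k; have := gC z; have := Fg (z + h).
  by have := Fg (z - h); lra.
- move=> y a; rewrite lte_fin => ak; pose e := k y - a.
  have e0 : 0 < e by rewrite subr_gt0.
  exists [set z | F (y + h) - e < F (z + h) /\ F (y - h) - e < F (z - h)].
    by apply: filterI; exact: envelope_shift_near.
  move=> z [/= h1 h2]; rewrite lte_fin.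
  by move: h1 h2; rewrite /e /k; lra.
- move=> t a b t01; rewrite /k.
  have mix s : t *: a + (1 - t) *: b + s = t *: (a + s) + (1 - t) *: (b + s).
    by rewrite !scalerDr [RHS]addrACA -(scalerDl s) subrKC scale1r.
  rewrite !mix; have := envelope_convex (a + h) (b + h) t01.
  have := envelope_convex (a - h) (b - h) t01; lra.
Qed.

End Envelope.

(** * The interpolating envelope *)

Section InterpolatingEnvelope.
Context {R : realType} {X : completeNormedModType R} {ip : {dot X for idfun}}.
Context (ip_norm : inner_product_norm ip).
Context {w : R -> R} (w_modulus : modulus w).
Context {E : set X} (E_neq0 : E !=set0) {f : X -> R} {G : X -> X}.
Context {M : R} (M_gt0 : 0 < M) (fG_CW : CW ip w E f G M).

(** Apply CW to [y] and [z], and Young's inequality to the numbers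
    [`|G y - G z| / M] and [`|x - y|]: the conjugate term absorbs
    [ip (G z - G y) (x - y)]. *)
Lemma affine_le_majorant x y z : E y -> E z ->
  f z + ip (G z) (x - z) <=
  f y + ip (G y) (x - y) + M * primitive w `|x - y|.
Proof.
move=> Ey Ez; set s := `|x - y|.
have young : (((M^-1 * `|G y - G z|) * s - primitive w s)%:E <=
    conjugate (primitive w) (M^-1 * `|G y - G z|)%R)%E.
  by apply: ereal_sup_ubound; exists s => //=; rewrite in_itv/= andbT normr_ge0.
have : ((f z + ip (G z) (y - z) +
    M * ((M^-1 * `|G y - G z|) * s - primitive w s))%:E <= (f y)%:E)%E.
  apply: le_trans (fG_CW Ey Ez); rewrite [leLHS]EFinD leeD2l// EFinM.
  by rewrite lee_wpmul2l// lee_fin ltW.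
rewrite lee_fin mulrBr !mulrA mulfV ?gt_eqF// mul1r.
have := cauchy_schwarz ip_norm (G z - G y) (x - y).
rewrite -/s (distrC (G z)) ipBl !ipBr; lra.
Qed.

Lemma upper_function_fin x :
  (fine (upper_function ip w E f G M x))%:E = upper_function ip w E f G M x.
Proof.
have [y Ey] := E_neq0; rewrite fineK// fin_real//; apply/andP; split.
  apply: (@lt_le_trans _ _ (f y + ip (G y) (x - y))%:E); first exact: ltNyr.
  apply: le_ereal_inf_tmp => _ [z Ez <-]; rewrite lee_fin.
  exact: affine_le_majorant.
apply: le_lt_trans (ltry (f y + ip (G y) (x - y) + M * primitive w `|x - y|)).
by apply: ereal_inf_lbound; exists y.
Qed.

Context {g : X -> R} (gE : forall x, (g x)%:E = upper_function ip w E f G M x).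

Lemma upper_le x y : E y ->
  g x <= f y + ip (G y) (x - y) + M * primitive w `|x - y|.
Proof. by move=> Ey; rewrite -lee_fin gE; apply: ereal_inf_lbound; exists y. Qed.

Lemma upper_ge x c :
  (forall y, E y -> c <= f y + ip (G y) (x - y) + M * primitive w `|x - y|) ->
  c <= g x.
Proof.
move=> hc; rewrite -lee_fin gE; apply: le_ereal_inf_tmp => _ [y Ey <-].
by rewrite lee_fin hc.
Qed.

Lemma affine_le_upper x z : E z -> f z + ip (G z) (x - z) <= g x.
Proof. by move=> Ez; apply: upper_ge => y Ey; exact: affine_le_majorant. Qed.

Lemma upper_diff2 x h :
  g (x + h) + g (x - h) <= 2 * g x + 2 * M * primitive w `|h|.
Proof.
suff : (g (x + h) + g (x - h)) / 2 - M * primitive w `|h| <= g x by lra.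
apply: upper_ge => y Ey.
have := upper_le (x + h) Ey; have := upper_le (x - h) Ey.
rewrite (addrAC x h) (addrAC x (- h)) !(ipDr (x - y)) ipNr.
have : M * (primitive w `|x - y + h| + primitive w `|x - y - h|) <=
    M * (2 * primitive w `|x - y| + 2 * primitive w `|h|).
  rewrite ler_pM2l//; apply: primitive_parallelogram => //.
  exact: (parallelogram ip_norm).
lra.
Qed.

Lemma envelope_fin x :
  (fine (convex_envelope g x))%:E = convex_envelope g x.
Proof.
have [z Ez] := E_neq0; rewrite fineK// fin_real//; apply/andP; split.
  apply: (lt_le_trans (ltNyr _)).
  apply: (affine_le_convex_envelope ip_norm
    (c := f z - ip (G z) z) (v := G z)) => y.
  by have := affine_le_upper y Ez; rewrite ipBr; lra.
exact: le_lt_trans (convex_envelope_le _ _) (ltry _).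
Qed.

Context {F : X -> R} (FE : forall x, (F x)%:E = convex_envelope g x).

Lemma envelope_le x : F x <= g x.
Proof. by rewrite -lee_fin FE convex_envelope_le. Qed.

Lemma affine_le_envelope x z : E z -> f z + ip (G z) (x - z) <= F x.
Proof.
move=> Ez; rewrite -lee_fin FE.
have -> : f z + ip (G z) (x - z) = f z - ip (G z) z + ip (G z) x.
  by rewrite ipBr; ring.
apply: (affine_le_convex_envelope ip_norm) => y.
by have := affine_le_upper y Ez; rewrite ipBr; lra.
Qed.

Lemma envelope_interpolates x : E x -> F x = f x.
Proof.
move=> Ex; apply/le_anti/andP; split.
  apply: le_trans (envelope_le x) _.
  have := upper_le x Ex; rewrite subrr normr0 (primitive0 (w:=w)) mulr0 addr0.
  by rewrite -(scale0r 0) ipZr mul0r addr0.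
have := affine_le_envelope x Ex.
by rewrite subrr -(scale0r 0) ipZr mul0r addr0.
Qed.

Lemma data_subgradient x : E x -> subgradient ip F x (G x).
Proof.
move=> Ex h; have := affine_le_envelope (x + h) Ex.
by rewrite (addrC x) addrK (envelope_interpolates Ex).
Qed.

Let rho t := 2 * M * primitive w t.

Lemma envelope_diff2_le x h : F (x + h) + F (x - h) <= 2 * F x + rho `|h|.
Proof. by apply: (envelope_diff2 FE) => z; exact: upper_diff2. Qed.

Let rho_le t : 0 <= t -> rho t <= 2 * M * (t * w t).
Proof. by move=> t0; rewrite ler_pM2l ?mulr_gt0// primitive_le. Qed.

Lemma rho_small e : 0 < e ->
  exists2 d, 0 < d & forall t, 0 <= t -> t < d -> rho t <= e * t.
Proof.
move=> e0; have M2 : 0 < 2 * M by rewrite mulr_gt0.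
have [d d0 wd] := modulus_cvg0 w_modulus (divr_gt0 e0 M2).
exists d => // t t0 td; apply: le_trans (rho_le t0) _.
rewrite mulrCA mulrC ler_wpM2r// mulrC -ler_pdivlMr// ltW//.
exact: wd.
Qed.

(** [F (x + h)] is bounded above for [`|h| <= 1], because [F (x - h)] is bounded
    below by an affine function and the second difference of [F] is bounded. *)
Lemma envelope_subgradient x : exists v, subgradient ip F x v.
Proof.
have [z Ez] := E_neq0.
apply: (subgradient_exists ip_norm (envelope_convex FE) rho_small
  envelope_diff2_le (B := F x + 2 * M * w 1 - f z - ip (G z) (x - z) + `|G z|)).
move=> h h1; have := envelope_diff2_le x h.
have : rho `|h| <= 2 * M * w 1.
  apply: le_trans (rho_le (normr_ge0 h)) _; rewrite ler_pM2l ?mulr_gt0//.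
  rewrite -[leRHS]mul1r ler_pM// ?(modulus_le w_modulus)//.
  by case: w_modulus => + _; apply.
have := affine_le_envelope (x - h) Ez; rewrite addrAC ipBr.
have : ip (G z) h <= `|G z|.
  apply: le_trans (cauchy_schwarz ip_norm _ _) _.
  by rewrite -[leRHS]mulr1 ler_wpM2l.
lra.
Qed.

Lemma envelope_grad_of_subgradient x v :
  subgradient ip F x v -> is_gradient ip F x v.
Proof. exact: (subgradient_is_gradient ip_norm rho_small envelope_diff2_le). Qed.

Lemma envelope_is_gradient x : is_gradient ip F x (grad ip F x).
Proof.
have [v /envelope_grad_of_subgradient Fv] := envelope_subgradient x.
by rewrite (gradE ip_norm Fv).
Qed.

Lemma envelope_grad_data x : E x -> grad ip F x = G x.
Proof.
move=> /data_subgradient/envelope_grad_of_subgradient; exact: gradE.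
Qed.

Lemma envelope_grad_dist x y :
  `|grad ip F x - grad ip F y| <= 4 * M * w `|x - y|.
Proof.
have [u Fu] := envelope_subgradient x; have [v Fv] := envelope_subgradient y.
rewrite (gradE ip_norm (envelope_grad_of_subgradient Fu)).
rewrite (gradE ip_norm (envelope_grad_of_subgradient Fv)).
have [xy|xy] := eqVneq x y.
  have w0 : w 0 = 0 by case: w_modulus => _ [].
  have -> : u = v.
    apply: (is_gradient_unique ip_norm (F := F) (x := x)).
      exact: envelope_grad_of_subgradient.
    by rewrite xy; exact: envelope_grad_of_subgradient.
  by rewrite xy !subrr !normr0 w0 mulr0.
have r0 : 0 < `|x - y| by rewrite normr_gt0 subr_eq0.
rewrite -(ler_pM2r r0).
apply: le_trans (subgradient_dist ip_norm envelope_diff2_le Fu Fv) _.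
by have := rho_le (ltW r0); lra.
Qed.

Lemma envelope_grad_seminorm :
  (modulus_seminorm w [set: X] (grad ip F) <= (8 * M)%:E)%E.
Proof.
apply: ge_ereal_sup => _ [[x y] /= [_ _ xy] <-]; rewrite lee_fin.
have r0 : 0 < `|x - y| by rewrite normr_gt0 subr_eq0.
have w0 : 0 < w `|x - y|.
  case: w_modulus => _ [_ w_incr _ w0 _].
  by rewrite -w0; apply: w_incr; rewrite // in_itv/= andbT// ltW.
rewrite ler_pdivrMr//; apply: le_trans (envelope_grad_dist x y) _.
by have := mulr_gt0 M_gt0 w0; lra.
Qed.

End InterpolatingEnvelope.

Theorem theorem4p11 (R : realType) (X : completeNormedModType R)
  (ip : {dot X for idfun}) (ip_norm : inner_product_norm ip)
  (w : R -> R) (w_modulus : modulus w)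
  (E : set X) (E_neq0 : E !=set0) (f : X -> R) (G : X -> X)
  (M : R) (M_gt0 : 0 < M) (fG_CW : CW ip w E f G M) :
  exists g F : X -> R,
    [/\ forall x, (g x)%:E = upper_function ip w E f G M x
      & forall x, (F x)%:E = convex_envelope g x] /\
    [/\ C1w ip w F,
        convex_function [set: X] F,
        forall x, E x -> F x = f x
      & forall x, E x -> grad ip F x = G x] /\
    [/\ forall x y, `|grad ip F x - grad ip F y| <= 4 * M * w (2 * `|x - y|)
      & (modulus_seminorm w [set: X] (grad ip F) <= (8 * M)%:E)%E].
Proof.
pose g x := fine (upper_function ip w E f G M x).
pose F x := fine (convex_envelope g x).
have gE x : (g x)%:E = upper_function ip w E f G M x.
  exact: upper_function_fin.
have FE x : (F x)%:E = convex_envelope g x.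
  exact: (envelope_fin ip_norm E_neq0 M_gt0 fG_CW gE).
have grad_dist := envelope_grad_dist ip_norm w_modulus E_neq0 M_gt0 fG_CW gE FE.
have grad_seminorm :=
  envelope_grad_seminorm ip_norm w_modulus E_neq0 M_gt0 fG_CW gE FE.
exists g, F; split; [by []|split; split] => //.
- split=> [x|]; last exact: le_lt_trans grad_seminorm (ltry _).
  exact: (envelope_is_gradient ip_norm w_modulus E_neq0 M_gt0 fG_CW gE FE).
- by move=> t x y _ _; apply: (envelope_convex FE); apply/andP; split.
- exact: (envelope_interpolates ip_norm M_gt0 fG_CW gE FE).
- exact: (envelope_grad_data ip_norm w_modulus M_gt0 fG_CW gE FE).
- move=> x y; apply: le_trans (grad_dist x y) _.
  rewrite ler_pM2l ?mulr_gt0//; apply: (modulus_le w_modulus) => //.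
  by rewrite ler_peMl// ler1n.
Qed.
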